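(* Let $m\ge 1$, let $p>m$ be a prime, and let $\mathcal{F}=\{f_0,\ldots,f_m\}\subset\mathbb{F}_p[X_0,\ldots,X_m]$ be a family of $m+1$ polynomials of total degree $d\ge 2$ of the form $$f_i=X_i\,g_i(X_{i+1},\ldots,X_m)+h_i(X_{i+1},\ldots,X_m)\quad (i=0,\ldots,m-1),\qquad f_m=aX_m+b,$$ where $a,b\in\mathbb{F}_p$, $a\neq 0$, $g_i,h_i\in\mathbb{F}_p[X_{i+1},\ldots,X_m]$, and for each $i=0,\ldots,m-1$ $$g_i=X_{i+1}^{s_{i,i+1}}\cdots X_m^{s_{i,m}}+\widetilde{g}_i(X_{i+1},\ldots,X_m),\qquad \deg\widetilde{g}_i<\deg g_i=s_{i,i+1}+\cdots+s_{i,m},\qquad \deg h_i\le\deg g_i,$$ with nonnegative integers $s_{i,j}$ and $\widetilde g_i\in\mathbb{F}_p[X_{i+1},\ldots,X_m]$, and such that $s_{0,1}s_{1,2}\cdots s_{m-1,m}\neq 0$. Let the sequence $\{\mathbf{u}_n\}$ be generated by $\mathcal{F}$ from some initial values $u_{0,0},\ldots,u_{0,m}$ (see context), and assume that it is purely periodic with period $T$. Then for any fixed integer $\nu\ge 1$ and any positive integer $N\le T$, the bound $$\max_{\gcd(a_0,\ldots,a_{m-1},p)=1}\left|S_{\mathbf{a}}(N)\right|=O\left(p^{\alpha_{m,\nu}}N^{1-\beta_{m,\nu}}\right)$$ holds, where the maximum is over integer vectors $\mathbf{a}=(a_0,\ldots,a_{m-1})\in\mathbb{Z}^m$, $$\alpha_{m,\nu}=\frac{2m^2+2m\nu+2m+\nu}{4\nu(m+\nu)}\qquad\text{and}\qquad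 \beta_{m,\nu}=\frac{1}{2\nu},$$ and the implied constant depends only on $d$, $m$ and $\nu$.
   Context: $\deg$ denotes total degree, and the zero polynomial has degree $-\infty$; the total degree of the family $\mathcal{F}$ is the largest total degree of its members. Elements of $\mathbb{F}_p$ are identified with the integers $0,\ldots,p-1$. Given initial values $u_{0,0},\ldots,u_{0,m}\in\{0,\ldots,p-1\}$, define $$u_{n+1,i}\equiv f_i(u_{n,0},\ldots,u_{n,m})\pmod p,\qquad 0\le u_{n+1,i}<p,\qquad i=0,\ldots,m,\ n=0,1,\ldots.$$ Put $\mathbf{w}_n=(u_{n,0},\ldots,u_{n,m})$ and $\mathbf{u}_n=(u_{n,0},\ldots,u_{n,m-1})$ (the last component is discarded). ''Purely periodic with period $T$'' means that $T$ is the least positive integer with $\mathbf{w}_{n+T}=\mathbf{w}_n$ for all $n\ge 0$ (so also $\mathbf{u}_{n+T}=\mathbf{u}_n$ for all $n\ge 0$). Put $\mathbf{e}(z)=\exp(2\pi i z/p)$ and, for $\mathbf{a}=(a_0,\ldots,a_{m-1})\in\mathbb{Z}^m$, $$S_{\mathbf{a}}(N)=\sum_{n=0}^{N-1}\mathbf{e}\left(\sum_{i=0}^{m-1}a_iu_{n,i}\right).$$ *)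

(* Defs.v *)
From HB Require Import structures.
From mathcomp Require Import all_boot all_order all_algebra.
From mathcomp Require Import reals exp trigo.
From mathcomp Require Import complex.
From mathcomp Require Import mpoly.

Set Implicit Arguments.
Unset Strict Implicit.
Unset Printing Implicit Defensive.

Import Order.TTheory GRing.Theory Num.Theory.
Local Open Scope ring_scope.

(* There are m + 1 variables X_0, ..., X_m, indexed by 'I_m.+1.  For i < m,
   [idx i] is the index i and [idxS i] the index i + 1, both in 'I_m.+1. *)
Definition idx (m : nat) (i : 'I_m) : 'I_m.+1 := widen_ord (leqnSn m) i.
Definition idxS (m : nat) (i : 'I_m) : 'I_m.+1 := lift ord0 i.

(* q is a polynomial in the variables X_{i+1}, X_{i+2}, ... only. *)
Definition in_vars_gt (F : fieldType) (n i : nat) (q : {mpoly F[n]}) : Prop :=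
  forall (mon : 'X_{1..n}) (j : 'I_n), mon \in msupp q -> (j <= i)%N ->
    mon j = 0%N.

(* The total degree of a family; [msize q] is deg q + 1, and 0 for q = 0, so
   the zero polynomial is counted as having degree 0, which only matters for a
   family all of whose members vanish. *)
Definition family_degree (F : fieldType) (k n : nat)
    (f : 'I_k -> {mpoly F[n]}) : nat :=
  (\max_(i < k) (msize (f i)).-1)%N.

(* w_n = (u_{n,0}, ..., u_{n,m}), with entries in 'F_p; the representative in
   {0, ..., p-1} of an entry is its value under the coercion of 'F_p to nat. *)
Fixpoint orbit_seq (p m : nat) (f : 'I_m.+1 -> {mpoly 'F_p[m.+1]})
    (w0 : {ffun 'I_m.+1 -> 'F_p}) (n : nat) : {ffun 'I_m.+1 -> 'F_p} :=
  if n is n'.+1 then [ffun i => (f i).@[orbit_seq f w0 n']] else w0.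

Definition purely_periodic (X : Type) (w : nat -> X) (T : nat) : Prop :=
  [/\ (0 < T)%N,
      forall n : nat, w (n + T)%N = w n
    & forall T' : nat, (0 < T')%N -> (forall n : nat, w (n + T')%N = w n) ->
        (T <= T')%N].

(* e(z) = exp (2 pi i z / p), by Euler's formula. *)
Definition e_ (R : realType) (p : nat) (z : int) : R[i] :=
  let t : R := 2 * pi * z%:~R / p%:R in Complex (cos t) (sin t).

(* S_a(N); the last component of w_n does not enter. *)
Definition exp_sum (R : realType) (p m : nat)
    (w : nat -> {ffun 'I_m.+1 -> 'F_p}) (a : 'I_m -> int) (N : nat) : R[i] :=
  \sum_(n < N) e_ R p (\sum_(i < m) a i * (w n (idx i) : nat)%:Z).

Definition alpha_ (R : realType) (m nu : nat) : R :=
  (2 * m ^ 2 + 2 * m * nu + 2 * m + nu)%N%:R / (4 * nu * (m + nu))%N%:R.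

Definition beta_ (R : realType) (nu : nat) : R := 1 / (2 * nu)%N%:R.

(* Main.v *)
Require Import Defs.
From HB Require Import structures.
From mathcomp Require Import all_boot all_order all_algebra.
From mathcomp Require Import reals exp trigo.
From mathcomp Require Import complex.
From mathcomp Require Import mpoly.
From mathcomp Require Import lra ring zify.

(** The orbit w_n is replaced by an average over all of F_p^(m+1), where the
iterates of the triangular system are polynomials that can be understood
exactly.

Write x_n for the n-th summand of S = S_a(N).  Shifting the summation by k
changes S by at most 2k, so for every K the product K |S| is, up to K^2, at most
the sum over n < N of |Y(w_n)|, where Y(v) sums the first K terms of the orbit
started at v ([shift_average]).  The power mean inequality ([power_mean]) brings
in the 2 nu-th moment of Y; pure periodicity makes w_0, ..., w_(T-1) distinct, so
this moment is at most the one over all v in F_p^(m+1) ([sum_orbit_le]).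

Expanding |Y(v)|^(2 nu) gives one complete exponential sum for each pair of
nu-tuples (k_j), (l_j) of indices below K ([moment_bound]).  If every l_j occurs
among the k_j, the sum is bounded trivially; there are at most nu^nu K^nu such
pairs.  Otherwise, let i be the first index with a_i not 0 mod p.  The l-th
iterate of f_i has the form X_i G_l + H_l, with G_l and H_l free of X_0, ..., X_i
and G_l the product of the g_i composed with the iterates of order below l.  The
phase is thus affine in X_i with slope a multiple of
A = sum_j G_(k_j) - sum_j G_(l_j), and summing over X_i leaves only the zeros of A
([char_sum_affine]); the Schwartz-Zippel bound ([schwartz_zippel]) says that there
are at most deg A * p^m of them, provided that A is not 0.

Two facts about degrees are needed.  From above, the triangular shape gives
deg G_l <= ((d+1) K)^m for l < K, by induction on the order of the iterate
([mdg_orbit], [mdg_gprod]).  From below, deg G_l strictly increases with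
l: the leading monomials of the f_i have a unitriangular exponent matrix, hence
substituting f is injective on polynomials ([tri_comp_neq0]), and g_i stays
nonconstant after any number of substitutions.  In A, the index l_j outside the
k's has a coefficient between -nu and -1, nonzero when p > nu, so degrees
cannot cancel ([multiset_diff_neq0]).  When p <= nu the trivial bound p^(m+1)
is already at most nu p^m.

Altogether the moment is at most a constant times
K^nu p^(m+1) + K^(2 nu + m) p^m.  The two terms balance for K about p^(1/(m+nu)).
With this choice |S|^(2 nu) is at most a constant times
N^(2 nu - 1) p^(m + 1 - nu/(m+nu)), and the exponent of p is at most 2 nu alpha
([exp_sum_core], [root_bound]). *)

Set Implicit Arguments.
Unset Strict Implicit.
Unset Printing Implicit Defensive.

Import Order.TTheory GRing.Theory Num.Theory.
Local Open Scope ring_scope.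

(** * Counting zeros of multivariate polynomials over a finite field *)

Section SchwartzZippel.
Variable n : nat.

(** [mnmext] and [mnmres] split a monomial in n+1 variables into a monomial in the
first n and the exponent of the last: they index the coefficients of [muni]. *)
Definition mnmext (m : 'X_{1..n}) (e : nat) : 'X_{1..n.+1} :=
  (mnmwiden m + U_(ord_max) *+ e)%MM.

Definition mnmres (m : 'X_{1..n.+1}) : 'X_{1..n} :=
  [multinom m (widen_ord (leqnSn n) i) | i < n].

Lemma mnmext_last m e : mnmext m e ord_max = e.
Proof. by rewrite mnmDE mulmnE mnm1E eqxx mnmwiden_ordmax mul1n. Qed.

Lemma mnmext_widen m e i : mnmext m e (widen_ord (leqnSn n) i) = m i.
Proof.
rewrite mnmDE mulmnE mnm1E mnmwiden_widen.
by rewrite -val_eqE /= gtn_eqF // addn0.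
Qed.

Lemma mnmext_eq m e (k : 'X_{1..n.+1}) :
  (k == mnmext m e) = (mnmres k == m) && (k ord_max == e).
Proof.
apply/eqP/andP => [->|[/eqP km /eqP ke]].
  rewrite mnmext_last eqxx; split=> //; apply/eqP/mnmP => i.
  by rewrite mnmE mnmext_widen.
apply/mnmP => i; case: (unliftP ord_max i) => [j ->|->]; last first.
  by rewrite mnmext_last.
have ->: lift ord_max j = widen_ord (leqnSn n) j.
  by apply/val_inj; rewrite /= /bump leqNgt ltn_ord.
by rewrite mnmext_widen -km mnmE.
Qed.

Lemma mdeg_ext m e : mdeg (mnmext m e) = (mdeg m + e)%N.
Proof.
rewrite mdegE big_ord_recr /= mnmext_last mdegE; congr (_ + _)%N.
by apply: eq_bigr => i _; rewrite mnmext_widen.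
Qed.

Lemma muni_coef (R : comNzRingType) (q : {mpoly R[n.+1]}) e m :
  ((muni q)`_e)@_m = q@_(mnmext m e).
Proof.
rewrite muniE coef_sum raddf_sum /= [in RHS](mpolyE q) raddf_sum /=.
apply: eq_bigr => k _; rewrite -/(mnmres k) coefZ coefXn mcoeffZ.
rewrite mcoeffX mnmext_eq.
rewrite (eq_sym e); case: (k ord_max == e); rewrite ?andbT ?andbF ?mulr1 ?mulr0.
  by rewrite mcoeffZ mcoeffX.
by rewrite mcoeff0.
Qed.

Lemma muni_eval (R : comNzRingType) (q : {mpoly R[n.+1]}) (v : 'I_n.+1 -> R) :
  q.@[v] = (map_poly (meval (fun i => v (widen_ord (leqnSn n) i))) (muni q)).[v ord_max].
Proof.
rewrite muniE rmorph_sum /= horner_sum mevalE; apply: eq_bigr => k _.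
rewrite map_polyZ /= map_polyXn hornerZ hornerXn mevalZ mevalX.
rewrite big_ord_recr /= mulrA; congr (_ * _ * _).
by apply: eq_bigr => i _; rewrite mnmE.
Qed.

Lemma muni_neq0 (R : comNzRingType) (q : {mpoly R[n.+1]}) : q != 0 -> muni q != 0.
Proof.
apply: contra_neq => q0; apply/mpolyP => k.
have /eqP-> : k == mnmext (mnmres k) (k ord_max) by rewrite mnmext_eq !eqxx.
by rewrite -muni_coef q0 coef0 !mcoeff0.
Qed.

(** The leading monomial of the leading coefficient of [muni q], multiplied by the
top power of the last variable, occurs in q. *)
Lemma muni_lead_msize (R : comNzRingType) (q : {mpoly R[n.+1]}) : q != 0 ->
  ((msize (lead_coef (muni q))).-1 + (size (muni q)).-1 <= (msize q).-1)%N.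
Proof.
move=> /muni_neq0 q0; have c0 : lead_coef (muni q) != 0 by rewrite lead_coef_eq0.
rewrite -(mlead_deg c0) /= -mdeg_ext -ltnS.
have /msize_mdeg_lt lt : mnmext (mlead (lead_coef (muni q))) (size (muni q)).-1
   \in msupp q by rewrite mcoeff_msupp -muni_coef mleadc_eq0.
by rewrite prednK // (leq_ltn_trans _ lt).
Qed.

End SchwartzZippel.

Lemma sum_ffun_recr (F : finType) n (G : {ffun 'I_n.+1 -> F} -> nat) :
  (\sum_v G v = \sum_(v : {ffun 'I_n -> F}) \sum_(x : F)
     G [ffun i => oapp v x (unlift ord_max i)])%N.
Proof.
rewrite pair_big /=.
rewrite (reindex (fun vx : {ffun 'I_n -> F} * F =>
   [ffun i => oapp vx.1 vx.2 (unlift ord_max i)])) //=.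
exists (fun v : {ffun 'I_n.+1 -> F} => ([ffun i => v (lift ord_max i)], v ord_max)).
  case=> v x _; congr pair; last by rewrite ffunE unlift_none.
  by apply/ffunP => i; rewrite !ffunE liftK.
move=> v _; apply/ffunP => i; rewrite ffunE; case: unliftP => [j ->|->] //=.
by rewrite ffunE.
Qed.

(** Induction on the number of variables.  With q of degree e in the last variable
and leading coefficient c there, a point whose first coordinates do not annihilate
c extends to at most e zeros, and the others are counted by induction for c.
Stating the bound multiplied by #|F| covers n = 0, where #|F|^(n-1) would have
no meaning. *)
Lemma schwartz_zippel (F : finFieldType) n (q : {mpoly F[n]}) : q != 0 ->
  (#|[set v : {ffun 'I_n -> F} | q.@[v] == 0%R]| * #|F| <=
     (msize q).-1 * #|F| ^ n)%N.
Proof.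
elim: n q => [|n IHn] q q0.
  rewrite (_ : [set v | _] = set0) ?cards0 ?mul0n //.
  apply/setP => v; rewrite !inE; apply/negbTE; move: q0; apply: contra_neq.
  move=> qv0; apply/mpolyP => m; rewrite mcoeff0 -qv0 [in RHS](mpolyE q).
  have m0 (k : 'X_{1..0}) : k = m by apply/mnmP => -[].
  rewrite [in LHS](mpolyE q) !raddf_sum /=; apply: eq_bigr => k _.
  by rewrite mcoeffZ mcoeffX mevalZ mevalX big_ord0 (m0 k) eqxx.
set c := lead_coef (muni q); set e := (size (muni q)).-1.
have c0 : c != 0 by rewrite lead_coef_eq0 muni_neq0.
have IHc := IHn c c0.
rewrite -sum1dep_card big_mkcond /= sum_ffun_recr.
have inner (v : {ffun 'I_n -> F}) :
  (\sum_x (if q.@[[ffun i => oapp v x (unlift ord_max i)]] == 0%R then 1 else 0)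
    <= (c.@[v] == 0%R) * #|F| + e)%N.
  rewrite -big_mkcond /= sum1dep_card; case: eqP => [_|/eqP cv].
    by rewrite mul1n (leq_trans _ (leq_addr _ _)) // max_card.
  rewrite mul0n add0n; set P := map_poly (meval v) (muni q).
  have P0 : P != 0.
    apply: contraNneq cv => P0; have : P`_e = 0 by rewrite P0 coef0.
    by rewrite coef_map => ->.
  have sP : ((size P).-1 <= e)%N.
    by rewrite /e -!subn1 leq_sub2r // size_poly.
  apply: leq_trans sP; rewrite -ltnS prednK ?size_poly_gt0 //.
  rewrite cardE; apply: max_poly_roots => //; last by rewrite enum_uniq.
  apply/allP => x; rewrite mem_enum inE => /eqP qx; apply/rootP.
  rewrite -qx muni_eval ffunE unlift_none /=; congr (_.[_]).
  apply/polyP => i; rewrite !coef_map /=; apply: meval_eq => j.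
  rewrite ffunE (_ : widen_ord _ j = lift ord_max j) ?liftK //.
  by apply/val_inj; rewrite /= /bump leqNgt ltn_ord.
apply: (@leq_trans ((#|[set v : {ffun 'I_n -> F} | c.@[v] == 0%R]| * #|F|
    + e * #|F| ^ n) * #|F|)).
  rewrite leq_mul2r; apply/orP; right; apply: leq_trans (leq_sum _ _) _ => //.
    by move=> v _; exact: inner.
  rewrite big_split /= -big_distrl /= sum_nat_const card_ffun card_ord.
  rewrite [(_ * e)%N]mulnC -sum1dep_card.
  by rewrite [in X in (_ <= X)%N]big_mkcond.
rewrite expnSr mulnA leq_mul2r; apply/orP; right.
apply: leq_trans (leq_mul (muni_lead_msize q0) (leqnn _)).
by rewrite -/c -/e mulnDl leq_add2r.
Qed.

(** * Total degree *)

(** Total degree with value 0 at the zero polynomial, so that sub-additivity under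
products and the bound for sums hold without side conditions. *)
Notation mdg p := (msize p).-1.

Section TotalDegree.
Variables (F : fieldType) (n : nat).
Implicit Types p q : {mpoly F[n]}.

Lemma mdgD p q : (mdg (p + q) <= maxn (mdg p) (mdg q))%N.
Proof.
have := msizeD_le p q; rewrite !leq_max -!subn1.
by case/orP => /(leq_sub2r 1) ->; rewrite ?orbT.
Qed.

Lemma mdgM p q : (mdg (p * q) <= mdg p + mdg q)%N.
Proof.
have [->|p0] := eqVneq p 0; first by rewrite mul0r msize0.
have [->|q0] := eqVneq q 0; first by rewrite mulr0 msize0.
by rewrite msizeM // (mpolySpred _ p0) (mpolySpred _ q0) addnS.
Qed.

Lemma mdg_prod (I : Type) (r : seq I) (P : pred I) (G : I -> {mpoly F[n]}) :
  (mdg (\prod_(i <- r | P i) G i) <= \sum_(i <- r | P i) mdg (G i))%N.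
Proof.
elim/big_rec2: _ => [|i k p _ le]; first by rewrite msize1.
by rewrite (leq_trans (mdgM _ _)) // leq_add2l.
Qed.

Lemma mdgX p k : (mdg (p ^+ k) <= k * mdg p)%N.
Proof.
rewrite -[k in _ ^+ k](card_ord k) -prodr_const.
by rewrite (leq_trans (mdg_prod _ _ _)) // sum_nat_const card_ord.
Qed.

Lemma mdg_sum (I : eqType) (r : seq I) (P : pred I) (G : I -> {mpoly F[n]}) D :
  (forall i, i \in r -> P i -> (mdg (G i) <= D)%N) ->
  (mdg (\sum_(i <- r | P i) G i) <= D)%N.
Proof.
move=> le; rewrite big_seq_cond; elim/big_ind: _ => [|p q hp hq|i /andP[]]; last exact: le.
  by rewrite msize0.
by rewrite (leq_trans (mdgD _ _)) // geq_max hp.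
Qed.

Lemma mdgZ_le c p : (mdg (c *: p) <= mdg p)%N.
Proof.
have [->|c0] := eqVneq c 0; first by rewrite scale0r msize0.
by rewrite msizeZ.
Qed.

Lemma mleadDl_msize p q : (msize q < msize p)%N -> mlead (p + q) = mlead p.
Proof.
have [->|q0] := eqVneq q 0; first by rewrite addr0.
have [->|p0] := eqVneq p 0; first by rewrite msize0 ltn0.
by rewrite -(mlead_deg p0) -(mlead_deg q0) ltnS => lt; apply/mleadDl/lt_mdeg_ltmc.
Qed.

Lemma msizeDl p q : (msize q < msize p)%N -> msize (p + q) = msize p.
Proof.
move=> lt; have p0 : p != 0 by apply: contraTneq lt => ->; rewrite msize0 ltn0.
have pq0 : p + q != 0.
  apply: contraTneq lt => /eqP; rewrite addr_eq0 => /eqP ->.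
  by rewrite mmeasureN ltnn.
by rewrite -(mlead_deg p0) -(mlead_deg pq0) mleadDl_msize.
Qed.

(** A nontrivial combination of polynomials of distinct degrees keeps the degree of
its last nonzero term. *)
Lemma lincomb_neq0 (G : nat -> {mpoly F[n]}) K (c : 'I_K -> F) (k0 : 'I_K) :
  {homo (fun k => msize (G k)) : k k' / (k < k')%N} -> G 0%N != 0 ->
  c k0 != 0 -> \sum_k c k *: G k != 0.
Proof.
move=> incr G0 ck0.
have Gn0 k : G k != 0.
  case: k => // k; rewrite -msize_poly_eq0 -lt0n.
  by apply: leq_trans (incr 0%N k.+1 _).
case: (@arg_maxnP _ k0 (fun k => c k != 0) (fun k => k : nat) ck0) => k ck kmax.
rewrite (bigD1 k) //= -msize_poly_eq0 msizeDl ?msize_poly_eq0.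
  by rewrite scaler_eq0 negb_or ck Gn0.
apply: leq_ltn_trans (msize_sum _ _ _) _; rewrite msizeZ //.
rewrite -[X in (_ < X)%N](prednK (n := msize (G k))) ?ltnS; last first.
  by rewrite lt0n msize_poly_eq0.
apply/bigmax_leqP => i ik; have [->|ci] := eqVneq (c i) 0.
  by rewrite scale0r msize0.
rewrite msizeZ // -ltnS prednK; last by rewrite lt0n msize_poly_eq0.
by apply: incr; rewrite ltn_neqAle ik /=; apply: kmax.
Qed.

End TotalDegree.

(** * Substitution of polynomials *)

Section Substitution.
Variables (F : fieldType) (n : nat).
Implicit Types (p q : {mpoly F[n]}) (P Q : n.-tuple {mpoly F[n]}).

Lemma comp_mpolyA q P Q :
  (q \mPo P) \mPo Q = q \mPo [tuple tnth P i \mPo Q | i < n].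
Proof.
rewrite (comp_mpolyEX q P) [RHS]comp_mpolyEX raddf_sum /=; apply: eq_bigr => k _.
rewrite comp_mpolyZ comp_mpolyX [in RHS]comp_mpolyX rmorph_prod /=.
congr (_ *: _); apply: eq_bigr => i _; by rewrite rmorphXn /= tnth_mktuple.
Qed.

Lemma mdg_comp i q P D : in_vars_gt i q ->
  (forall j : 'I_n, (i < j)%N -> (mdg (tnth P j) <= D)%N) ->
  (mdg (q \mPo P) <= mdg q * D)%N.
Proof.
move=> qi PD; rewrite comp_mpolyE; apply: mdg_sum => k kq _.
apply: leq_trans (mdgZ_le _ _) _; apply: leq_trans (mdg_prod _ _ _) _.
apply: (@leq_trans (mdeg k * D)); last first.
  by rewrite leq_mul2r -ltnS (leq_trans (msize_mdeg_lt kq)) ?orbT ?leqSpred.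
rewrite mdegE big_distrl /=; apply: leq_sum => j _.
apply: leq_trans (mdgX _ _) _; have [ji|ij] := leqP j i.
  by rewrite (qi _ _ kq ji).
by rewrite leq_mul2l PD ?orbT.
Qed.

Lemma meval_in_vars i q (v v' : 'I_n -> F) : in_vars_gt i q ->
  (forall j : 'I_n, (i < j)%N -> v j = v' j) -> q.@[v] = q.@[v'].
Proof.
move=> qi vv; rewrite !mevalE big_seq [RHS]big_seq; apply: eq_bigr => k kq.
congr (_ * _); apply: eq_bigr => j _; have [ji|ij] := leqP j i.
  by rewrite (qi _ _ kq ji).
by rewrite vv.
Qed.

Lemma seq_argmax (T : eqType) d (L : orderType d) (h : T -> L) (s : seq T) :
  s != [::] -> exists2 x, x \in s & forall y, y \in s -> (h y <= h x)%O.
Proof.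
elim: s => // x s IHs _; have [->|/IHs[y ys ymax]] := eqVneq s [::].
  by exists x => [|y]; rewrite inE // => /eqP ->.
have [hxy|hyx] := leP (h x) (h y); [exists y|exists x]; rewrite ?inE ?eqxx ?ys ?orbT //.
  by move=> z; rewrite inE => /predU1P[->|/ymax].
move=> z; rewrite inE => /predU1P[->|/ymax hz] //.
by apply: le_trans hz (ltW hyx).
Qed.

(** The leading monomial of the image of a monomial k is [L k], where L is given by
the exponent matrix of the leading monomials of the P_i.  That matrix is triangular
with nonzero diagonal, so L is injective: among the images of the monomials of q,
the one with the greatest leading monomial cannot be cancelled. *)
Lemma comp_triangular_neq0 q P :
  (forall i, tnth P i != 0) ->
  (forall i j : 'I_n, (j < i)%N -> mlead (tnth P i) j = 0%N) ->
  (forall i, (0 < mlead (tnth P i) i)%N) ->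
  q != 0 -> q \mPo P != 0.
Proof.
move=> P0 Plt Peq q0.
pose L (k : 'X_{1..n}) := (\sum_(i < n) mlead (tnth P i) *+ k i)%MM.
pose M (k : 'X_{1..n}) := \prod_(i < n) tnth P i ^+ k i.
have leadM k : mlead (M k) = L k.
  rewrite mlead_prod => [|i _ _]; last by rewrite expf_neq0.
  by apply: eq_bigr => i _; rewrite mleadX.
have M0 k : M k != 0 by apply/prodf_neq0 => i _; rewrite expf_neq0.
have Linj : injective L.
  move=> k k' Lkk; apply/mnmP => i.
  have [N iN] := ubnP (i : nat); elim: N i iN => // N IH i; rewrite ltnS => iN.
  have /eqP := congr1 (fun u : 'X_{1..n} => u i) Lkk.
  rewrite !mnm_sumE (bigD1 i) //= [X in _ == X](bigD1 i) //=.
  rewrite (eq_bigr (fun j => (mlead (tnth P j) *+ k' j)%MM i)) => [|j ji].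
    by rewrite eqn_add2r !mulmnE eqn_pmul2l ?Peq // => /eqP.
  rewrite !mulmnE; have [ij|ij] := ltnP i j; first by rewrite Plt.
  rewrite IH // (leq_trans _ iN) // ltn_neqAle ij andbT.
  by apply: contra ji => /eqP ji; apply/eqP/val_inj.
have sq0 : msupp q != [::] by rewrite msupp_eq0.
have [k kq kmax] := seq_argmax L sq0.
apply/eqP => /(congr1 (fun r : {mpoly F[n]} => r@_(L k))).
rewrite comp_mpolyE mcoeff0 raddf_sum /= (bigD1_seq k) ?msupp_uniq //=.
rewrite [X in _ + X]big1_seq.
  move/eqP; rewrite addr0 mcoeffZ mulf_eq0 -leadM mleadc_eq0 (negbTE (M0 _)) orbF.
  by rewrite mcoeff_eq0 kq.
move=> k' /andP[kk kq']; have lt : (mlead (M k') < L k)%O.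
  rewrite leadM lt_neqAle kmax // andbT.
  by apply: contra kk => /eqP /Linj ->.
by rewrite mcoeffZ (mcoeff_gt_mlead lt) mulr0.
Qed.

End Substitution.

(** * Iteration of a triangular system *)

Lemma leq_expWl a b e : (a <= b -> a ^ e <= b ^ e)%N.
Proof. by case: e => // e ab; rewrite leq_exp2r. Qed.

(** What the leading-monomial and degree arguments use of the family f.  The condition
on [h i] makes X_i * g_i the leading part of f_i, so that the shape of the leading
monomial of f_i can be read from the variables of g_i. *)
Record triangular_system (F : fieldType) (m d : nat)
    (f : 'I_m.+1 -> {mpoly F[m.+1]}) (g h : 'I_m -> {mpoly F[m.+1]}) : Prop := {
  tri_def : forall i, f (idx i) = 'X_(idx i) * g i + h i;
  tri_last : exists ab : F * F,
    ab.1 != 0 /\ f ord_max = ab.1 *: 'X_ord_max + ab.2%:MP;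
  tri_gvars : forall i : 'I_m, in_vars_gt i (g i);
  tri_hvars : forall i : 'I_m, in_vars_gt i (h i);
  tri_gnonconst : forall i, (1 < msize (g i))%N;
  tri_hg : forall i, (msize (h i) <= msize (g i))%N;
  tri_deg : forall i, (mdg (g i) <= d)%N }.

(** The iterates as polynomials in the initial point: evaluating [poly_orbit f l] at v
gives the l-th term of the orbit of v. *)
Fixpoint poly_orbit (F : fieldType) n (f : 'I_n -> {mpoly F[n]}) (l : nat) :
    n.-tuple {mpoly F[n]} :=
  if l is l'.+1 then [tuple f i \mPo poly_orbit f l' | i < n]
  else [tuple 'X_i | i < n].

Lemma tnth_poly_orbitS (F : fieldType) n (f : 'I_n -> {mpoly F[n]}) l i :
  tnth (poly_orbit f l.+1) i = f i \mPo poly_orbit f l.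
Proof. by rewrite tnth_mktuple. Qed.

Lemma ord_last_case m (P : 'I_m.+1 -> Prop) :
  (forall i : 'I_m, P (idx i)) -> P ord_max -> forall i, P i.
Proof.
move=> Pidx Pmax i; case: (unliftP ord_max i) => [j ->|->] //.
have ->: lift ord_max j = idx j; last exact: Pidx.
by apply/val_inj; rewrite /= /bump leqNgt ltn_ord.
Qed.

Section TriangularSystem.
Variables (F : fieldType) (m d : nat).
Variables (f : 'I_m.+1 -> {mpoly F[m.+1]}) (g h : 'I_m -> {mpoly F[m.+1]}).
Hypothesis tri : triangular_system d f g h.

Let g_neq0 i : g i != 0.
Proof. by rewrite -msize_poly_eq0 -lt0n (ltn_trans _ (tri_gnonconst tri i)). Qed.

Lemma tri_msize i : (msize (h i) < msize ('X_(idx i) * g i))%N.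
Proof.
rewrite msizeM // ?msizeX ?mdeg1 /= ?ltnS ?tri_hg //; first exact: tri_hg tri i.
by rewrite -msize_poly_eq0 msizeX.
Qed.

Lemma tri_lead i : mlead (f (idx i)) = (U_(idx i) + mlead (g i))%MM.
Proof.
rewrite (tri_def tri) mleadDl_msize ?tri_msize // mleadM ?mleadXm //.
by rewrite -msize_poly_eq0 msizeX.
Qed.

Lemma tri_lead_last : mlead (f ord_max) = U_(ord_max)%MM.
Proof.
have [[a b] [/= a0 ->]] := tri_last tri.
rewrite mleadDl_msize ?mleadZ ?mleadXm // msizeZ // msizeX mdeg1.
by rewrite (leq_ltn_trans (_ : _ <= 1)%N) // msizeC; case: (b != 0).
Qed.

Lemma tri_lead_vars (i : 'I_m) (j : 'I_m.+1) : (j <= i)%N -> mlead (g i) j = 0%N.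
Proof. by apply: (tri_gvars tri); apply: mlead_supp. Qed.

(** The leading monomial of f_i is X_i times a monomial in the later variables, which
is the unitriangular situation of [comp_triangular_neq0]. *)
Lemma tri_comp_neq0 q : q != 0 -> q \mPo [tuple f i | i < m.+1] != 0.
Proof.
have lead0 i : mlead (f i) i != 0%N -> f i != 0.
  by apply: contra => /eqP ->; rewrite mlead0 mnm0E.
have diag i : (0 < mlead (f i) i)%N.
  elim/ord_last_case: i => [i|]; last by rewrite tri_lead_last mnm1E eqxx.
  by rewrite tri_lead mnmDE mnm1E eqxx.
apply: comp_triangular_neq0 => [i|i j ji|i]; rewrite tnth_mktuple //.
  by rewrite lead0 // -lt0n.
elim/ord_last_case: i ji => [i|]; last first.
  by rewrite tri_lead_last mnm1E -val_eqE /= => /gtn_eqF ->.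
rewrite tri_lead mnmDE mnm1E -val_eqE /= => ji.
by rewrite (gtn_eqF ji) tri_lead_vars // ltnW.
Qed.

(** Peeling off the innermost application instead of the outermost one: substituting
the l-th iterate is the l-fold repetition of one substitution, and so inherits its
injectivity. *)
Lemma comp_orbitS q l :
  q \mPo poly_orbit f l.+1 = (q \mPo [tuple f i | i < m.+1]) \mPo poly_orbit f l.
Proof.
rewrite comp_mpolyA; congr (_ \mPo _).
by apply: eq_from_tnth => i; rewrite !tnth_mktuple.
Qed.

Lemma comp_orbit_neq0 q l : q != 0 -> q \mPo poly_orbit f l != 0.
Proof.
elim: l q => [|l IH] q q0; first by rewrite comp_mpoly_id.
by rewrite comp_orbitS IH // tri_comp_neq0.
Qed.

(** If q composed with an iterate were a constant c, then q - c would be a nonzero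
polynomial in the kernel of the substitution. *)
Lemma comp_orbit_nonconst q l : (1 < msize q)%N ->
  (1 < msize (q \mPo poly_orbit f l))%N.
Proof.
rewrite !ltnNge; apply: contra => /msize1_polyC; set c := _@_0%MM => qc.
have : (q - c%:MP) \mPo poly_orbit f l = 0.
  by rewrite comp_mpolyB comp_mpolyC qc subrr.
move/eqP; apply: contraTT; rewrite -ltnNge => q1; apply: comp_orbit_neq0.
apply: contraTneq q1 => /eqP; rewrite subr_eq0 => /eqP ->.
by rewrite -leqNgt msizeC; case: (c != 0).
Qed.

(** Each step adds to the degree of the j-th component at most
d * max_(k > j) deg f_k^(l), which by induction is of order l^(m-j-1); summing over
the steps raises the exponent by one.  The base (d+1)(l+1) is chosen so that the
increment fits:
((d+1)(l+1))^(e+1) + d ((d+1)(l+1))^e <= ((d+1)(l+2))^(e+1). *)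
Lemma mdg_orbit l (j : 'I_m.+1) :
  (mdg (tnth (poly_orbit f l) j) <= (d.+1 * l.+1) ^ (m - j))%N.
Proof.
elim: l j => [|l IH] j.
  by rewrite tnth_mktuple msizeX mdeg1 muln1 expn_gt0.
rewrite tnth_poly_orbitS; elim/ord_last_case: j => [j|].
  have IHj q (qj : in_vars_gt j q) := mdg_comp (P := poly_orbit f l)
    (D := ((d.+1 * l.+1) ^ (m - j).-1)%N) qj _.
  have {}IHj q : in_vars_gt j q ->
    (mdg (q \mPo poly_orbit f l) <= mdg q * (d.+1 * l.+1) ^ (m - j).-1)%N.
    move=> qj; apply: IHj => // k jk; apply: leq_trans (IH k) _.
    rewrite leq_pexp2l // -subnS leq_sub2l //.
  have mj : (m - j = (m - j).-1.+1)%N by rewrite prednK // subn_gt0.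
  rewrite (tri_def tri) comp_mpolyD rmorphM /= comp_mpolyXU -tnth_nth.
  apply: leq_trans (mdgD _ _) _; set B := (_ ^ _)%N in IHj.
  apply: (@leq_trans ((d.+1 * l.+1) ^ (m - j) + d * B)).
    rewrite geq_max; apply/andP; split.
      apply: leq_trans (mdgM _ _) _; apply: leq_add; first exact: (IH (idx j)).
      have gj := IHj (g j) (tri_gvars tri (i := j)); apply: leq_trans gj _.
      by rewrite leq_mul2r (tri_deg tri) orbT.
    have hj := IHj (h j) (tri_hvars tri (i := j)); apply: leq_trans hj _.
    apply: leq_trans (leq_addl _ _).
    rewrite leq_mul2r (leq_trans _ (tri_deg tri j)) ?orbT //.
    by rewrite -!subn1 leq_sub2r // (tri_hg tri).
  rewrite /= mj !expnS /= -/B.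
  have BB : (B <= (d.+1 * l.+2) ^ (m - j).-1)%N by rewrite leq_expWl // leq_mul2l leqnSn orbT.
  nia.
have [[a b] [/= a0 ->]] := tri_last tri.
rewrite subnn expn0 comp_mpolyD comp_mpolyZ comp_mpolyC comp_mpolyXU -tnth_nth.
apply: leq_trans (mdgD _ _) _; rewrite geq_max; apply/andP; split.
  by apply: leq_trans (mdgZ_le _ _) _; have := IH ord_max; rewrite subnn.
by rewrite msizeC; case: (b != 0).
Qed.

(** The coefficient of X_i in the i-th component of the k-th iterate. *)
Definition gprod (i : 'I_m) (k : nat) : {mpoly F[m.+1]} :=
  \prod_(l < k) (g i \mPo poly_orbit f l).

Lemma gprod_neq0 i k : gprod i k != 0.
Proof. by apply/prodf_neq0 => l _; apply: comp_orbit_neq0. Qed.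

Lemma msize_gprod i : {homo (fun k => msize (gprod i k)) : k k' / (k < k')%N}.
Proof.
apply: homo_ltn => [x y z|k]; first exact: ltn_trans.
rewrite {2}/gprod big_ord_recr -/(gprod i k) /= msizeM ?gprod_neq0 ?comp_orbit_neq0 //.
have := comp_orbit_nonconst k (tri_gnonconst tri i); move: (msize _) => x.
by case: x => [|[|x]] // _; rewrite !addnS /= ltnS leq_addr.
Qed.

Lemma mdg_gprod i k K : (k <= K)%N -> (0 < K)%N ->
  (mdg (gprod i k) <= (d.+1 * K) ^ m)%N.
Proof.
move=> kK K0; have m0 : (m = m.-1.+1)%N by case: (m) i => // -[].
apply: leq_trans (mdg_prod _ _ _) _.
apply: (@leq_trans (\sum_(l < k) d.+1 * (d.+1 * K) ^ m.-1)).
  apply: leq_sum => l _.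
  apply: leq_trans (mdg_comp (i := i) (D := ((d.+1 * K) ^ m.-1)%N) _ _) _.
  - exact: tri_gvars tri i.
  - move=> j ij; apply: leq_trans (mdg_orbit _ _) _.
    apply: (@leq_trans ((d.+1 * K) ^ (m - j))).
      by rewrite leq_expWl // leq_mul2l (leq_trans _ kK) ?orbT.
    by rewrite leq_pexp2l // ?muln_gt0 // -subn1 leq_sub2l // (leq_ltn_trans _ ij).
  by rewrite leq_mul2r (leq_trans (tri_deg tri i)) // orbT.
rewrite sum_nat_const card_ord [X in (_ <= _ ^ X)%N]m0 expnS mulnA [(k * _)%N]mulnC.
by rewrite leq_mul2r leq_mul2l kK !orbT.
Qed.

End TriangularSystem.


(** The two sums are collected by the value of the index.  At [l j0] the first sum
contributes nothing and the second between 1 and nu copies, a multiplicity that is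
nonzero in F; [lincomb_neq0] then applies. *)
Lemma multiset_diff_neq0 (F : fieldType) n (G : nat -> {mpoly F[n]}) K nu
    (k l : {ffun 'I_nu -> 'I_K}) (j0 : 'I_nu) :
  {homo (fun k => msize (G k)) : k k' / (k < k')%N} -> G 0%N != 0 ->
  (forall r, (0 < r <= nu)%N -> r%:R != 0 :> F) ->
  l j0 \notin codom k ->
  \sum_j G (k j) - \sum_j G (l j) != 0.
Proof.
move=> incr G0 nuF lk.
have fib (u : {ffun 'I_nu -> 'I_K}) :
    \sum_j G (u j) = \sum_(x < K) #|[pred j | u j == x]|%:R *: G x.
  rewrite (partition_big u predT) //=; apply: eq_bigr => x _.
  rewrite (eq_bigr (fun=> G x)) => [|j /eqP -> //].
  by rewrite sumr_const scaler_nat.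
rewrite !fib -sumrB.
rewrite (eq_bigr (fun x : 'I_K =>
  (#|[pred j | k j == x]|%:R - #|[pred j | l j == x]|%:R) *: G x)).
  apply: (@lincomb_neq0 _ _ _ _ _ (l j0)) => //.
  rewrite (_ : #|[pred j | k j == l j0]| = 0%N).
    rewrite sub0r oppr_eq0 nuF //; apply/andP; split.
      by rewrite lt0n; apply/pred0Pn; exists j0; rewrite /= eqxx.
    by rewrite -[X in (_ <= X)%N]card_ord max_card.
  apply: eq_card0 => j; rewrite !inE; apply: contraNF lk => /eqP <-.
  exact: codom_f.
by move=> x _; rewrite scalerBl.
Qed.

(** * Power means, moments and shifted sums *)

Section Analytic.
Variable C : numClosedFieldType.

(** Twice the difference of the two sides is the sum over all pairs (i, j) of the
products (y_i - y_j) (z_i - z_j). *)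
Lemma chebyshev_sum (I : Type) (s : seq I) (y z : I -> C) :
  (forall i j, 0 <= (y i - y j) * (z i - z j)) ->
  (\sum_(i <- s) y i) * (\sum_(i <- s) z i) <= (size s)%:R * \sum_(i <- s) y i * z i.
Proof.
move=> yz.
have : 0 <= \sum_(i <- s) \sum_(j <- s) (y i - y j) * (z i - z j).
  by apply: sumr_ge0 => i _; apply: sumr_ge0.
have -> : \sum_(i <- s) \sum_(j <- s) (y i - y j) * (z i - z j) =
    ((size s)%:R * \sum_(i <- s) y i * z i) *+ 2 -
    ((\sum_(i <- s) y i) * \sum_(i <- s) z i) *+ 2.
  have cst (w : I -> C) : \sum_(i <- s) \sum_(j <- s) w i = (size s)%:R * \sum_(i <- s) w i.
    rewrite mulr_sumr; apply: eq_bigr => i _.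
    by rewrite big_const_seq count_predT iter_addr_0 mulr_natl.
  have dbl : (\sum_(i <- s) y i) * (\sum_(i <- s) z i) =
      \sum_(i <- s) \sum_(j <- s) y i * z j.
    by rewrite big_distrl /=; apply: eq_bigr => i _; rewrite mulr_sumr.
  transitivity (\sum_(i <- s) \sum_(j <- s) y i * z i +
      \sum_(i <- s) \sum_(j <- s) y j * z j -
      (\sum_(i <- s) \sum_(j <- s) y i * z j +
       \sum_(i <- s) \sum_(j <- s) y j * z i)).
    rewrite -!big_split -sumrB; apply: eq_bigr => i _.
    by rewrite -!big_split -sumrB; apply: eq_bigr => j _ /=; ring.
  rewrite [X in _ + X - _]exchange_big [X in _ - (_ + X)]exchange_big.
  by rewrite !cst -dbl !mulr2n.
by rewrite subr_ge0 ler_pMn2r.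
Qed.

(** Induction on the exponent, applying Chebyshev's inequality to y and y^r, which are
similarly ordered. *)
Lemma power_mean (I : Type) (s : seq I) (y : I -> C) r :
  (forall i, 0 <= y i) ->
  (\sum_(i <- s) y i) ^+ r.+1 <= (size s)%:R ^+ r * \sum_(i <- s) y i ^+ r.+1.
Proof.
move=> y0; elim: r => [|r IH].
  by rewrite expr0 mul1r; under [X in _ <= X]eq_bigr => i _ do rewrite expr1.
rewrite exprS; apply: (@le_trans _ _ ((\sum_(i <- s) y i) *
   ((size s)%:R ^+ r * \sum_(i <- s) y i ^+ r.+1))).
  by rewrite ler_wpM2l // sumr_ge0.
rewrite mulrCA exprSr -mulrA ler_wpM2l ?exprn_ge0 //.
apply: (le_trans (chebyshev_sum _ _)) => [i j|]; last first.
  by rewrite ler_wpM2l // le_eqVlt; under eq_bigr => i _ do rewrite -exprS; rewrite eqxx.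
have [yij|yji] := real_leP (ger0_real (y0 i)) (ger0_real (y0 j)).
  by rewrite mulr_le0 // subr_le0 // lerXn2r ?nnegrE.
by rewrite mulr_ge0 // subr_ge0 ?lerXn2r ?nnegrE // ltW.
Qed.

(** The 2 nu-th power is expanded over pairs (k, l) of nu-tuples.  Given k, the tuples l
with all entries among those of k number at most nu^nu; for them the inner sum is
bounded by #|V|, and for all the others by E. *)
Lemma moment_bound (V : finType) K nu (y : 'I_K -> V -> C) (E : C) : 0 <= E ->
  (forall k v, `|y k v| <= 1) ->
  (forall k l : {ffun 'I_nu -> 'I_K}, (exists j, l j \notin codom k) ->
     `|\sum_v \prod_j y (k j) v * (\prod_j y (l j) v)^*| <= E) ->
  \sum_v `|\sum_k y k v| ^+ (2 * nu) <=
     (nu ^ nu * K ^ nu * #|V|)%:R + (K ^ (2 * nu))%:R * E.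
Proof.
move=> E0 y1 yE.
have expand v : `|\sum_k y k v| ^+ (2 * nu) =
   \sum_(k : {ffun 'I_nu -> 'I_K}) \sum_(l : {ffun 'I_nu -> 'I_K})
      \prod_j y (k j) v * (\prod_j y (l j) v)^*.
  have pw : (\sum_k y k v) ^+ nu = \sum_(k : {ffun 'I_nu -> 'I_K}) \prod_j y (k j) v.
    by rewrite -[nu in LHS]card_ord -prodr_const bigA_distr_bigA.
  rewrite exprM normCK exprMn -rmorphXn /= pw rmorph_sum /= mulr_suml.
  by apply: eq_bigr => k _; rewrite mulr_sumr.
under eq_bigr => v _ do rewrite expand.
rewrite exchange_big /=.
under eq_bigr => k _ do rewrite exchange_big /=.
set S := (\sum_k _).
have Sreal : 0 <= S.
  rewrite /S; under eq_bigr => k _ do rewrite exchange_big /=.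
  rewrite exchange_big /=; apply: sumr_ge0 => v _.
  by rewrite -expand exprn_ge0.
rewrite -(ger0_norm Sreal) /S; apply: le_trans (ler_norm_sum _ _ _) _.
have inner (k : {ffun 'I_nu -> 'I_K}) :
  `|\sum_(l : {ffun 'I_nu -> 'I_K}) \sum_v \prod_j y (k j) v * (\prod_j y (l j) v)^*|
   <= (nu ^ nu * #|V|)%:R + (K ^ nu)%:R * E.
  apply: le_trans (ler_norm_sum _ _ _) _.
  rewrite (bigID (fun l : {ffun 'I_nu -> 'I_K} => l \in ffun_on (mem (codom k)))) /=.
  apply: lerD.
    apply: (@le_trans _ _ (\sum_(l in ffun_on (mem (codom k))) #|V|%:R)).
      apply: ler_sum => l _; apply: le_trans (ler_norm_sum _ _ _) _.
      rewrite -sum1_card natr_sum; apply: ler_sum => v _.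
      rewrite normrM norm_conjC !normr_prod mulr_ile1 ?prodr_ge0 //;
        apply: prodr_ile1 => j _; rewrite normr_ge0 y1 //.
    rewrite sumr_const -mulrnA ler_nat card_ffun_on card_ord mulnC leq_mul2r.
    by rewrite leq_expWl ?orbT // (leq_trans (leq_image_card _ _)) // card_ord.
  apply: (@le_trans _ _ (\sum_(l | l \notin ffun_on (mem (codom k))) E)).
    apply: ler_sum => l lk; apply: yE.
    by move: lk; rewrite inE negb_forall => /existsP.
  rewrite sumr_const -[X in X <= _]mulr_natl ler_wpM2r // ler_nat.
  by apply: leq_trans (max_card _) _; rewrite card_ffun !card_ord.
apply: (le_trans (ler_sum _ (fun k _ => inner k))).
rewrite sumr_const card_ffun !card_ord -[X in X <= _]mulr_natl mulrDr mulrA -!natrM.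
by rewrite mulnA [(K ^ nu * nu ^ nu)%N]mulnC mul2n -addnn expnD.
Qed.

(** Passing from the shift k to the shift k+1 replaces one summand, which costs at most
2; hence a total error of at most 0 + 2 + ... + 2 (K-1) <= K^2. *)
Lemma shift_average (x : nat -> C) N K : (forall n, `|x n| <= 1) ->
  `|K%:R * \sum_(n < N) x n - \sum_(n < N) \sum_(k < K) x (n + k)%N| <= (K ^ 2)%:R.
Proof.
move=> x1.
have shift k : `|\sum_(n < N) x n - \sum_(n < N) x (n + k)%N| <= (2 * k)%:R.
  elim: k => [|k IH].
    by under [X in _ - X]eq_bigr => n _ do rewrite addn0; rewrite subrr normr0.
  rewrite mulnS addnC natrD -[X in X - _](subrK (\sum_(n < N) x (n + k)%N)) -addrA.
  apply: le_trans (ler_normD _ _) (lerD IH _).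
  have -> : \sum_(n < N) x (n + k)%N - \sum_(n < N) x (n + k.+1)%N = x k - x (N + k)%N.
    have e : \sum_(n < N) x (n + k)%N + x (N + k)%N = x k + \sum_(n < N) x (n + k.+1)%N.
      transitivity (\sum_(n < N.+1) x (n + k)%N); first by rewrite big_ord_recr.
      rewrite big_ord_recl; congr (_ + _); apply: eq_bigr => n _.
      by rewrite lift0 addSnnS.
    rewrite (_ : \sum_(n < N) x (n + k)%N = x k + \sum_(n < N) x (n + k.+1)%N - x (N + k)%N).
      by ring.
    by rewrite -e addrK.
  apply: le_trans (ler_normB _ _) _.
  by rewrite (_ : 2%:R = 1 + 1) // lerD.
rewrite exchange_big /= mulr_natl -[X in _ *+ X]card_ord -sumr_const -sumrB.
apply: le_trans (ler_norm_sum _ _ _) _.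
apply: le_trans (ler_sum _ (fun (k : 'I_K) _ => shift k)) _.
rewrite -natr_sum ler_nat; elim: K => [|K IH]; first by rewrite big_ord0.
by rewrite big_ord_recr /= (leq_trans (leq_add IH (leqnn _))) // -!mulnn; nia.
Qed.

End Analytic.

(** * Complete sums of an additive character *)

Section CharacterSums.
Variables (C : numClosedFieldType) (F : finFieldType) (chi : F -> C).
Hypothesis chiD : forall x y, chi (x + y) = chi x * chi y.
Hypothesis chi0 : chi 0 = 1.
Hypothesis chi_norm : forall x, `|chi x| = 1.
Hypothesis chi_sum : \sum_x chi x = 0.

Lemma chi_sumr (I : Type) (s : seq I) (P : pred I) (G : I -> F) :
  chi (\sum_(i <- s | P i) G i) = \prod_(i <- s | P i) chi (G i).
Proof. exact: (big_morph chi chiD chi0). Qed.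

Lemma chi_conj x : (chi x)^* = chi (- x).
Proof.
have x0 : chi x != 0 by rewrite -normr_gt0 chi_norm ltr01.
apply: (mulfI x0); rewrite -chiD subrr chi0 -normCK chi_norm expr1n //.
Qed.

(** The sum is unchanged when v is translated by t in the direction i0.  Averaging over
t attaches to v the factor sum_t chi(t * A v), which vanishes unless A v = 0. *)
Lemma char_sum_affine n (i0 : 'I_n) (Phi A : {ffun 'I_n -> F} -> F) :
  (forall v t, Phi (v + [ffun i => if i == i0 then t else 0]) = Phi v + t * A v) ->
  `|\sum_v chi (Phi v)| <= #|[set v | A v == 0]|%:R.
Proof.
move=> PhiA; have F0 : #|F|%:R != 0 :> C.
  by rewrite pnatr_eq0 -lt0n; apply/card_gt0P; exists 0.
have key : #|F|%:R * \sum_v chi (Phi v) =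
   #|F|%:R * \sum_(v | A v == 0) chi (Phi v).
  transitivity (\sum_t \sum_v chi (Phi v + t * A v)).
    rewrite mulr_natl -sumr_const; apply: eq_bigr => t _.
    rewrite (reindex_inj (addIr [ffun i => if i == i0 then t else 0])) /=.
    by apply: eq_bigr => v _; rewrite PhiA.
  rewrite exchange_big /= [in RHS]big_mkcond mulr_sumr; apply: eq_bigr => v _.
  have [Av|Av] := eqVneq (A v) 0.
    under eq_bigr => t _ do rewrite Av mulr0 addr0.
    by rewrite sumr_const mulr_natl.
  under eq_bigr => t _ do rewrite chiD.
  have sum0 : \sum_t chi (t * A v) = 0.
    by rewrite -[RHS]chi_sum [RHS](reindex_inj (mulIf Av)) /=; apply: eq_bigl.
  by rewrite -mulr_sumr sum0 !mulr0.
rewrite (mulfI F0 key); apply: le_trans (ler_norm_sum _ _ _) _.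
rewrite -sum1dep_card natr_sum; apply: ler_sum => v _.
by rewrite chi_norm.
Qed.

End CharacterSums.

(** * Orbits over a prime field *)

Section Orbits.
Variables (p m : nat) (f : 'I_m.+1 -> {mpoly 'F_p[m.+1]}).
Implicit Types v : {ffun 'I_m.+1 -> 'F_p}.

Lemma orbit_seq_add v n k : orbit_seq f v (n + k) = orbit_seq f (orbit_seq f v n) k.
Proof. by elim: k => [|k IH]; rewrite ?addn0 // addnS /= IH. Qed.

Lemma meval_poly_orbit v l i : (tnth (poly_orbit f l) i).@[v] = orbit_seq f v l i.
Proof.
elim: l i => [|l IH] i; first by rewrite tnth_mktuple mevalXU.
rewrite tnth_poly_orbitS comp_mpoly_meval ffunE.
by apply: meval_eq => j; rewrite IH.
Qed.

Lemma meval_comp_orbit v l q : (q \mPo poly_orbit f l).@[v] = q.@[orbit_seq f v l].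
Proof. by rewrite comp_mpoly_meval; apply: meval_eq => j; rewrite meval_poly_orbit. Qed.

(** A coincidence w_n = w_n' with n < n' < T makes n' - n a period from index n on, and
pure periodicity carries it back to index 0, contradicting the minimality of T. *)
Lemma purely_periodic_inj v T : purely_periodic (orbit_seq f v) T ->
  {in [pred n | (n < T)%N] &, injective (orbit_seq f v)}.
Proof.
case=> T0 perT minT n n'; wlog lt : n n' / (n < n')%N => [hw nT n'T e|].
  have [nn|nn|//] := ltngtP n n'; first exact: hw.
  by apply/esym; apply: hw.
move=> _ n'T e; exfalso.
have perM k r : orbit_seq f v (r + k * T) = orbit_seq f v r.
  by elim: k => [|k IH]; rewrite ?addn0 // mulSn addnCA addnC perT.
have /minT : forall r, orbit_seq f v (r + (n' - n)) = orbit_seq f v r.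
  (* Shifting both indices by (n+1) T brings them beyond n, where n' - n is
     already known to be a period. *)
  move=> r; rewrite -(perM n.+1 r) -[LHS](perM n.+1).
  have nr : (n <= r + n.+1 * T)%N.
    by rewrite (leq_trans _ (leq_addl _ _)) // (leq_trans (leqnSn n)) // leq_pmulr.
  have -> : (r + n.+1 * T = n + (r + n.+1 * T - n))%N by rewrite subnKC.
  have -> : (r + (n' - n) + n.+1 * T = n' + (r + n.+1 * T - n))%N by lia.
  by rewrite !orbit_seq_add e.
rewrite subn_gt0 lt => /(_ isT); rewrite leqNgt => /negP; apply.
by rewrite (leq_ltn_trans (leq_subr _ _)).
Qed.

Definition lin (c : 'I_m -> 'F_p) v : 'F_p := \sum_(i < m) c i * v (idx i).

Variables (d : nat) (g h : 'I_m -> {mpoly 'F_p[m.+1]}).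
Hypothesis tri : triangular_system d f g h.

Definition shift_coord (i : 'I_m) v (t : 'F_p) : {ffun 'I_m.+1 -> 'F_p} :=
  v + [ffun j => if j == idx i then t else 0].

Lemma orbit_shift_gt (i : 'I_m) v t l (j : 'I_m.+1) : (i < j)%N ->
  orbit_seq f (shift_coord i v t) l j = orbit_seq f v l j.
Proof.
elim: l j => [|l IH] j ij /=.
  by rewrite !ffunE -val_eqE /= gtn_eqF // addr0.
rewrite !ffunE; elim/ord_last_case: j ij => [j|] ij.
  have agree (k : 'I_m.+1) : (j < k)%N ->
      orbit_seq f (shift_coord i v t) l k = orbit_seq f v l k.
    by move=> jk; apply: IH; apply: ltn_trans jk.
  rewrite (tri_def tri) !mevalD !mevalM !mevalXU IH //.
  by rewrite (meval_in_vars (tri_gvars tri (i := j)) agree)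
             (meval_in_vars (tri_hvars tri (i := j)) agree).
have [[a b] [/= _ ->]] := tri_last tri.
by rewrite !mevalD !mevalZ !mevalXU !mevalC IH.
Qed.

(** The components after the i-th do not see the i-th coordinate, so a perturbation of
that coordinate is just multiplied by the successive values of g_i. *)
Lemma orbit_shift_eq i v t l :
  orbit_seq f (shift_coord i v t) l (idx i) =
    orbit_seq f v l (idx i) + t * (gprod f g i l).@[v].
Proof.
elim: l => [|l IH] /=.
  by rewrite /gprod big_ord0 meval1 mulr1 !ffunE eqxx.
have agree (k : 'I_m.+1) : (i < k)%N ->
    orbit_seq f (shift_coord i v t) l k = orbit_seq f v l k.
  exact: orbit_shift_gt.
rewrite !ffunE (tri_def tri) !mevalD !mevalM !mevalXU IH.
rewrite (meval_in_vars (tri_gvars tri (i := i)) agree)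
        (meval_in_vars (tri_hvars tri (i := i)) agree).
rewrite /gprod big_ord_recr /= mevalM meval_comp_orbit; ring.
Qed.

Lemma lin_orbit_shift c (i : 'I_m) v t l : (forall j : 'I_m, (j < i)%N -> c j = 0) ->
  lin c (orbit_seq f (shift_coord i v t) l) =
    lin c (orbit_seq f v l) + t * (c i * (gprod f g i l).@[v]).
Proof.
move=> ci0; rewrite /lin (bigD1 i) //= [in RHS](bigD1 i) //= orbit_shift_eq.
rewrite (eq_bigr (fun j => c j * orbit_seq f v l (idx j))); first by ring.
move=> j ji; have [lt|ge] := ltnP j i; first by rewrite ci0 ?mul0r.
by rewrite orbit_shift_gt //= ltn_neqAle eq_sym ge andbT; move: ji; rewrite -val_eqE.
Qed.

End Orbits.

(** * The moment over all initial points, and the incomplete sum *)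

Section CoreEstimate.
Variables (C : numClosedFieldType) (p m d nu K : nat) (chi : 'F_p -> C).
Hypothesis p_prime : prime p.
Hypothesis chiD : forall x y, chi (x + y) = chi x * chi y.
Hypothesis chi0 : chi 0 = 1.
Hypothesis chi_norm : forall x, `|chi x| = 1.
Hypothesis chi_sum : \sum_x chi x = 0.
Variables (f : 'I_m.+1 -> {mpoly 'F_p[m.+1]}) (g h : 'I_m -> {mpoly 'F_p[m.+1]}).
Hypothesis tri : triangular_system d f g h.
Variable c : 'I_m -> 'F_p.
Hypothesis c_neq0 : exists i, c i != 0.
Hypothesis K_gt0 : (0 < K)%N.

Let y (k : 'I_K) v := chi (lin c (orbit_seq f v k)).
Let card_F : #|'F_p| = p. Proof. exact: card_Fp. Qed.

(** The summand nu in the bound is there for p <= nu: multiplicities may then vanish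
mod p, but the trivial bound p^(m+1) suffices. *)
Lemma offdiagonal_sum (k l : {ffun 'I_nu -> 'I_K}) :
  (exists j, l j \notin codom k) ->
  `|\sum_v \prod_j y (k j) v * (\prod_j y (l j) v)^*| <=
    ((((d.+1 * K) ^ m + nu) * p ^ m)%N)%:R.
Proof.
case=> j0 lk.
have [p_le|p_gt] := leqP p nu.
  apply: le_trans (ler_norm_sum _ _ _) _.
  apply: (@le_trans _ _ (\sum_(v : {ffun 'I_m.+1 -> 'F_p}) 1)).
    apply: ler_sum => v _; rewrite normrM norm_conjC !normr_prod.
    by rewrite !big1 ?mulr1 // => j _; rewrite chi_norm.
  rewrite sumr_const card_ffun card_F card_ord ler_nat expnS.
  by rewrite leq_mul2r (leq_trans p_le) ?orbT // leq_addl.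
(* The first active coordinate: the linear form sees the translation along it only
   through that coordinate itself. *)
have [i ci0 i_min] : exists2 i, c i != 0 & forall j : 'I_m, (j < i)%N -> c j = 0.
  case: c_neq0 => i1 ci1.
  case: (@arg_minnP _ i1 (fun i => c i != 0) (fun i => i : nat) ci1) => i ci imin.
  exists i => // j ji; apply/eqP; apply: contraTT ji => /imin.
  by rewrite -leqNgt.
pose G := gprod f g i.
pose A := \sum_j G (k j) - \sum_j G (l j).
have A0 : A != 0.
  apply: (multiset_diff_neq0 (j0 := j0)) => //.
  - exact: (msize_gprod tri).
  - exact: (gprod_neq0 tri).
  move=> r /andP[r0 rnu]; rewrite -(dvdn_pcharf (pchar_Fp p_prime)).
  by rewrite gtnNdvd // (leq_ltn_trans rnu).
have degA : (mdg A <= (d.+1 * K) ^ m)%N.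
  have le (u : {ffun 'I_nu -> 'I_K}) : (mdg (\sum_j G (u j)) <= (d.+1 * K) ^ m)%N.
    by apply: mdg_sum => j _ _; apply: (mdg_gprod tri) => //; apply: ltnW.
  apply: leq_trans (mdgD _ _) _.
  by rewrite geq_max le mmeasureN le.
pose Phi v := \sum_j lin c (orbit_seq f v (k j)) - \sum_j lin c (orbit_seq f v (l j)).
rewrite (eq_bigr (fun v => chi (Phi v))); last first.
  move=> v _; rewrite /Phi chiD -(chi_conj chiD chi0 chi_norm).
  by rewrite !(chi_sumr chiD chi0).
apply: (le_trans (char_sum_affine (i0 := idx i)
  (A := fun v => c i * A.@[v]) chiD chi_norm chi_sum _)).
  move=> v t.
  have shift (u : {ffun 'I_nu -> 'I_K}) :
      \sum_j lin c (orbit_seq f (shift_coord i v t) (u j)) =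
      \sum_j lin c (orbit_seq f v (u j)) + t * (c i * (\sum_j G (u j)).@[v]).
    rewrite raddf_sum /= !mulr_sumr -big_split; apply: eq_bigr => j _ /=.
    exact: (lin_orbit_shift tri).
  rewrite /Phi -/(shift_coord i v t) !shift /A mevalB; ring.
rewrite ler_nat -(leq_pmul2r (prime_gt0 p_prime)).
have := schwartz_zippel A0; rewrite card_F => SZ.
apply: leq_trans (_ : mdg A * p ^ m.+1 <= _)%N.
  apply: leq_trans SZ; rewrite leq_mul2r; apply/orP; right.
  apply: subset_leq_card; apply/subsetP => v; rewrite !inE mulf_eq0.
  by rewrite (negbTE ci0).
rewrite expnSr mulnA !leq_mul2r (leq_trans degA) ?orbT //.
exact: leq_addr.
Qed.

Lemma orbit_moment :
  \sum_v `|\sum_k y k v| ^+ (2 * nu) <=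
    (nu ^ nu * K ^ nu * p ^ m.+1 + K ^ (2 * nu) * (((d.+1 * K) ^ m + nu) * p ^ m))%:R.
Proof.
apply: (le_trans (moment_bound (nu := nu) _ _ offdiagonal_sum)) => //.
- by rewrite /y => k v; rewrite chi_norm.
- by rewrite card_ffun card_F card_ord -natrM -natrD.
Qed.

Variables (w0 : {ffun 'I_m.+1 -> 'F_p}) (T N : nat).
Hypothesis w_per : purely_periodic (orbit_seq f w0) T.
Hypothesis N_gt0 : (0 < N)%N.
Hypothesis N_le : (N <= T)%N.
Hypothesis nu_gt0 : (0 < nu)%N.
Hypothesis m_gt0 : (0 < m)%N.
Hypothesis K_le : (K ^ (m + nu) <= p)%N.

Let x n := chi (lin c (orbit_seq f w0 n)).

Lemma sum_orbit_le (G : {ffun 'I_m.+1 -> 'F_p} -> C) : (forall v, 0 <= G v) ->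
  \sum_(n < N) G (orbit_seq f w0 n) <= \sum_v G v.
Proof.
move=> G0; rewrite -(big_imset (h := fun n : 'I_N => orbit_seq f w0 n) G) /=.
  rewrite [X in _ <= X](bigID (fun v => v \in (fun n : 'I_N => orbit_seq f w0 n) @: 'I_N)) /=.
  by rewrite lerDl sumr_ge0.
move=> n n' _ _ /(purely_periodic_inj w_per) e; apply/val_inj/e => //;
  by rewrite inE (leq_trans (ltn_ord _)).
Qed.

(** The estimate in terms of K, before optimizing.  If K <= N, the error K^2 of the
averaging is dominated by the main term, since
K^(4 nu) <= N^(2 nu - 1) K^nu p^(m+1).  If N < K, the trivial bound |S| <= N is
good enough. *)
Lemma exp_sum_core :
  `|\sum_(n < N) x n| ^+ (2 * nu) * (K ^ nu)%:R <=
    (4 ^ nu * (nu ^ nu + d.+1 ^ m + nu + 1) * N ^ (2 * nu).-1 * p ^ m.+1)%:R.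
Proof.
set S := `|_|; set B := (nu ^ nu + d.+1 ^ m + nu)%N.
have S0 : 0 <= S by rewrite normr_ge0.
have nu2 : (2 * nu = (2 * nu).-1.+1)%N by rewrite prednK // muln_gt0.
have Kp : (K ^ nu.+1 <= p ^ m.+1)%N.
  apply: leq_trans (_ : K ^ (m + nu) <= _)%N.
    by rewrite leq_pexp2l // -addn1 addnC leq_add2r.
  by apply: leq_trans K_le _; rewrite -[X in (X <= _)%N]expn1 leq_pexp2l // prime_gt0.
have [NK|KN] := ltnP N K.
  have SN : S <= N%:R.
    apply: le_trans (ler_norm_sum _ _ _) _.
    rewrite (eq_bigr (fun=> 1)) => [|n _]; last by rewrite chi_norm.
    by rewrite sumr_const card_ord.
  apply: (@le_trans _ _ ((N ^ (2 * nu) * K ^ nu)%:R)).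
    by rewrite natrM ler_wpM2r // natrX lerXn2r ?nnegrE.
  have NKp : (N * K ^ nu <= p ^ m.+1)%N.
    by apply: leq_trans Kp; rewrite expnS leq_mul2r (ltnW NK) orbT.
  rewrite ler_nat {1}nu2 expnS mulnAC (leq_trans (leq_mul NKp (leqnn _))) //.
  by rewrite mulnC -mulnA leq_pmull // muln_gt0 expn_gt0 addn1.
pose Y v := `|\sum_k y k v|.
pose W := \sum_(n < N) Y (orbit_seq f w0 n).
have W0 : 0 <= W by apply: sumr_ge0 => n _; rewrite /Y.
have KS : K%:R * S <= W + (K ^ 2)%:R.
  have /(shift_average (x := x) N K) sh : forall n, `|x n| <= 1.
    by move=> n; rewrite /x chi_norm.
  rewrite /S -[X in X * _]normr_nat -normrM.
  rewrite -[X in `|X|](subrK (\sum_(n < N) \sum_(k < K) x (n + k)%N)) addrC.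
  apply: le_trans (ler_normD _ _) _; apply: lerD sh.
  apply: le_trans (ler_norm_sum _ _ _) _; apply: ler_sum => n _.
  rewrite le_eqVlt; apply/orP; left; apply/eqP; congr (`|_|).
  by apply: eq_bigr => k _; rewrite /x /y orbit_seq_add.
have WB : W ^+ (2 * nu) <= (N ^ (2 * nu).-1 * (K ^ nu * p ^ m.+1 * B))%:R.
  rewrite nu2; apply: (le_trans (power_mean _ _ _)) => [n|]; first by rewrite /Y.
  have -> : size (index_enum 'I_N) = N by rewrite -sum1_size sum1_card card_ord.
  rewrite natrM natrX ler_wpM2l ?exprn_ge0 // -nu2.
  apply: (le_trans (sum_orbit_le (G := fun v => Y v ^+ (2 * nu)) _)).
    by move=> v; rewrite exprn_ge0 // /Y.
  apply: (le_trans orbit_moment); rewrite ler_nat.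
  have Kpow : (K ^ (2 * nu) * ((d.+1 * K) ^ m + nu) <= K ^ nu * p * (d.+1 ^ m + nu))%N.
    rewrite mul2n -addnn expnD -!mulnA leq_mul2l; apply/orP; right.
    rewrite expnMn; apply: (@leq_trans (K ^ nu * (K ^ m * (d.+1 ^ m + nu)))).
      rewrite leq_mul2l; apply/orP; right; rewrite mulnDr mulnC leq_add2l.
      by rewrite leq_pmull // expn_gt0 K_gt0.
    by rewrite mulnA -expnD [(nu + m)%N]addnC leq_mul2r K_le orbT.
  rewrite mulnA (leq_trans (leq_add (leqnn _) (leq_mul Kpow (leqnn _)))) //.
  rewrite /B expnS; nia.
have pm : (W + (K ^ 2)%:R) ^+ (2 * nu) <=
    (4 ^ nu)%:R * (W ^+ (2 * nu) + (K ^ (4 * nu))%:R).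
  have := @power_mean C bool [:: true; false]
    (fun b => if b then W else (K ^ 2)%:R) (2 * nu).-1.
  rewrite -nu2 !big_cons !big_nil !addr0 /= => pm.
  apply: (le_trans (pm _)) => [[]//|].
  have -> : (K ^ 2)%:R ^+ (2 * nu) = (K ^ (4 * nu))%:R :> C.
    by rewrite -natrX -expnM mulnA.
  apply: ler_wpM2r.
    by rewrite addr_ge0 ?exprn_ge0.
  by rewrite -natrX ler_nat (_ : 4 = 2 ^ 2)%N // -expnM leq_pexp2l // leq_pred.
have KK : (K ^ (4 * nu) <= N ^ (2 * nu).-1 * (K ^ nu * p ^ m.+1))%N.
  apply: (@leq_trans (K ^ (2 * nu).-1 * (K ^ nu * K ^ nu.+1))).
    by rewrite -!expnD leq_pexp2l //; lia.
  by rewrite leq_mul ?leq_mul // leq_expWl.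
have Kpos : (0 : C) < (K ^ nu)%:R by rewrite ltr0n expn_gt0 K_gt0.
rewrite -(ler_pM2r Kpos) -mulrA -natrM -expnD addnn -mul2n natrX -exprMn -natrM.
rewrite [S * _]mulrC.
apply: (le_trans (lerXn2r _ _ _ KS)); rewrite ?nnegrE ?mulr_ge0 ?addr_ge0 //.
apply: (le_trans pm).
apply: (@le_trans _ _ ((4 ^ nu)%:R * (N ^ (2 * nu).-1 * (K ^ nu * p ^ m.+1 * B) +
   N ^ (2 * nu).-1 * (K ^ nu * p ^ m.+1))%:R)).
  by rewrite ler_wpM2l // natrD lerD // ler_nat.
rewrite -!natrM ler_nat /B; nia.
Qed.

End CoreEstimate.

(** * The standard additive character of F_p *)

Section StandardCharacter.
Variables (R : realType) (p : nat).
Hypothesis p_prime : prime p.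

Let p_neq0 : (p%:R : R) != 0.
Proof. by rewrite pnatr_eq0 -lt0n prime_gt0. Qed.

Lemma e_D (z t : int) : e_ R p (z + t) = e_ R p z * e_ R p t.
Proof.
rewrite /e_ intrD [2 * pi * (_ + _)]mulrDr [(_ + _) / _]mulrDl cosD sinD.
by apply/eqP; rewrite eq_complex /= eqxx addrC eqxx.
Qed.

Lemma e_0 : e_ R p 0 = 1.
Proof. by rewrite /e_ mulr0 mul0r cos0 sin0. Qed.

Lemma e_p : e_ R p p%:Z = 1.
Proof. by rewrite /e_ -pmulrn mulfK // mulrC -mulr_natr mul1r mulr_natr cos2pi sin2pi. Qed.

Lemma e_pMn (n : nat) : e_ R p (p * n)%N%:Z = 1.
Proof.
elim: n => [|n IH]; first by rewrite muln0 e_0.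
by rewrite mulnS PoszD e_D e_p IH mul1r.
Qed.

Lemma e_norm z : `|e_ R p z| = 1.
Proof. by rewrite normc_def /= cos2Dsin2 sqrtr1. Qed.

(** For p >= 2 the angle 2 pi / p lies in ]0, pi], where cos is injective. *)
Lemma e_1_neq1 : e_ R p 1 != 1.
Proof.
rewrite /e_ mulr1 eq_complex /= negb_and; apply/orP; left.
have pp : (2 : R) <= p%:R by rewrite ler_nat prime_gt1.
have p0 : (0 : R) < p%:R by lra.
have t0 : 0 < 2 * pi / p%:R :> R by rewrite divr_gt0 // mulr_gt0 // pi_gt0.
rewrite lt_eqF // -[X in _ < X](@cos0 R) ltr_cos // !in_itv /= ?lexx ?pi_ge0 //.
rewrite ltW //= ler_pdivrMr // mulrC ler_pM2l // pi_gt0 //.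
Qed.

Definition std_char (x : 'F_p) : R[i] := e_ R p (x : nat)%:Z.

Lemma std_char_nat (n : nat) : std_char n%:R = e_ R p n%:Z.
Proof.
rewrite /std_char val_Fp_nat // [in RHS](divn_eq n p) PoszD e_D.
by rewrite mulnC e_pMn mul1r.
Qed.

Lemma std_charD x y : std_char (x + y) = std_char x * std_char y.
Proof.
by rewrite -[x in LHS]natr_Zp -[y in LHS]natr_Zp -natrD std_char_nat PoszD e_D.
Qed.

Lemma std_char0 : std_char 0 = 1.
Proof. exact: e_0. Qed.

Lemma std_char_int (z : int) : std_char z%:~R = e_ R p z.
Proof.
case: z => n; first by rewrite -pmulrn std_char_nat.
have en0 : e_ R p n.+1%:Z != 0 by rewrite -normr_gt0 e_norm ltr01.
rewrite NegzE mulrNz -pmulrn; apply: (mulIf en0).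
by rewrite -[RHS]e_D [in RHS]addNr e_0 -std_char_nat -std_charD addNr std_char0.
Qed.

(** Translating the variable by 1 multiplies the sum by e(1), which is not 1. *)
Lemma std_char_sum : \sum_x std_char x = 0.
Proof.
have : std_char 1 * (\sum_x std_char x) = \sum_x std_char x.
  rewrite mulr_sumr [RHS](reindex_inj (addrI 1)) /=.
  by apply: eq_bigr => x _; rewrite std_charD.
move/eqP; rewrite -subr_eq0 -[X in _ - X]mul1r -mulrBl mulf_eq0 subr_eq0.
by rewrite (std_char_nat 1) (negbTE e_1_neq1) => /eqP.
Qed.

Lemma exp_sumE m (w : nat -> {ffun 'I_m.+1 -> 'F_p}) (c : 'I_m -> int) N :
  exp_sum R w c N = \sum_(n < N) std_char (lin (fun i => (c i)%:~R) (w n)).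
Proof.
apply: eq_bigr => n _; rewrite -std_char_int; congr std_char.
rewrite rmorph_sum; apply: eq_bigr => i _ /=.
by rewrite intrM -pmulrn natr_Zp.
Qed.

End StandardCharacter.

Lemma coprime_coef_neq0 p m (c : 'I_m -> int) : prime p ->
  gcdn (\big[gcdn/0%N]_(i < m) `|c i|%N) p = 1%N ->
  exists i, (c i)%:~R != 0 :> 'F_p.
Proof.
move=> p_prime gcd1; apply/existsP; apply: contraPT (gcd1) => /existsPn c0.
have pc i : (p %| `|c i|)%N.
  have := c0 i; rewrite negbK (dvdn_pcharf (pchar_Fp p_prime)).
  by case: (c i) => k //; rewrite NegzE mulrNz oppr_eq0.
have /gcdn_idPr -> : (p %| \big[gcdn/0%N]_(i < m) `|c i|)%N.
  by elim/big_rec: _ => [|i x _ px]; rewrite ?dvdn0 // dvdn_gcd pc.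
by move=> p1; move: p_prime; rewrite p1.
Qed.

(** The integer part K of the e-th root of p; since K + 1 <= 2 K, it is at least half
of the root. *)
Lemma trunc_root p e : (0 < e)%N -> (0 < p)%N ->
  exists K, [/\ (0 < K)%N, (K ^ e <= p)%N & (p <= (2 * K) ^ e)%N].
Proof.
move=> e0 p0; have ex1 : exists k, (k ^ e <= p)%N by exists 1%N; rewrite exp1n.
have bound k : (k ^ e <= p)%N -> (k <= p)%N.
  by apply: leq_trans; case: k => // k; rewrite -[X in (X <= _)%N]expn1 leq_pexp2l.
case: (ex_maxnP ex1 bound) => K Kp Kmax.
have K0 : (0 < K)%N by apply: Kmax; rewrite exp1n.
exists K; split=> //; apply: (@leq_trans (K.+1 ^ e)).
  by rewrite leqNgt; apply/negP => /ltnW /Kmax; rewrite ltnn.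
by rewrite leq_expWl // mul2n -addnn -addn1 leq_add2l.
Qed.

(** Here K^nu is at least 2^(-nu) p^(nu/(m+nu)), so r^(2 nu) is at most a constant times
N^(2 nu - 1) p^(m + 1 - nu/(m+nu)).  This exponent of p is below
2 nu alpha = m + 1 - nu / (2 (m+nu)), and 2 nu (1 - beta) = 2 nu - 1. *)
Lemma root_bound (R : realType) (r : R) (m nu p N K c : nat) :
  0 <= r -> (0 < m)%N -> (0 < nu)%N -> (0 < p)%N -> (0 < N)%N -> (0 < c)%N ->
  (p <= (2 * K) ^ (m + nu))%N ->
  r ^+ (2 * nu) * (K ^ nu)%:R <= (c * N ^ (2 * nu).-1 * p ^ m.+1)%:R ->
  r <= (c * 2 ^ nu)%:R * p%:R `^ alpha_ R m nu * N%:R `^ (1 - beta_ R nu).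
Proof.
move=> r0 m0 nu0 p0 N0 c0 pK rK.
have nur : (0 : R) < nu%:R by rewrite ltr0n.
have mr : (0 : R) < m%:R by rewrite ltr0n.
have pr : (0 : R) < p%:R by rewrite ltr0n.
have p1 : (1 : R) <= p%:R by rewrite ler1n.
have mnr : (m%:R + nu%:R : R) != 0 by rewrite gt_eqF // addr_gt0.
have nu2 : (2 * nu = (2 * nu).-1.+1)%N by rewrite prednK // muln_gt0.
rewrite -(ler_pXn2r (n := (2 * nu)%N)) ?nnegrE ?mulr_ge0 ?powR_ge0 ?ler0n //; last first.
  by rewrite muln_gt0.
rewrite !exprMn -!powR_mulrn ?powR_ge0 // -!powRrM.
pose t : R := nu%:R / (m%:R + nu%:R).
have t0 : 0 <= t by rewrite divr_ge0 ?addr_ge0 // ltW.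
have root2K : p%:R `^ t <= ((2 * K) ^ nu)%:R.
  have : p%:R <= ((2 * K)%:R `^ (m + nu)%:R) :> R.
    by rewrite powR_mulrn ?ler0n // -natrX ler_nat.
  move/(ge0_ler_powR t0) => /(_ _ _); rewrite !nnegrE ler0n powR_ge0 => /(_ isT isT).
  rewrite -powRrM (_ : (m + nu)%:R * t = nu%:R); first by rewrite powR_mulrn ?ler0n // natrX.
  by rewrite /t natrD mulrCA divff // mulr1.
have expN : (1 - beta_ R nu) * (2 * nu)%:R = (2 * nu).-1%:R.
  rewrite -subn1 natrB ?muln_gt0 // /beta_ mulrBl mul1r mul1r mulVf //.
  by rewrite pnatr_eq0 muln_eq0 -lt0n nu0.
have expp : m.+1%:R - t <= alpha_ R m nu * (2 * nu)%:R.
  have -> : alpha_ R m nu * (2 * nu)%:R = m.+1%:R - t / 2.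
    rewrite /alpha_ /t !(natrM, natrD, natrX) -natr1.
    by field; rewrite mnr gt_eqF.
  lra.
rewrite expN (powR_mulrn (2 * nu).-1) ?ler0n // powR_mulrn ?ler0n //.
have ptp : 0 < p%:R `^ t :> R by rewrite powR_gt0.
have ptE : p%:R `^ (m.+1%:R - t) * p%:R `^ t = p%:R ^+ m.+1 :> R.
  by rewrite -powRD ?(gt_eqF pr) ?implybT // subrK powR_mulrn ?ler0n.
apply: (@le_trans _ _ ((c * 2 ^ nu)%:R * p%:R `^ (m.+1%:R - t) * N%:R ^+ (2 * nu).-1)).
  rewrite -(ler_pM2r ptp) [X in _ <= X](_ : _ =
      (c * 2 ^ nu)%:R * p%:R ^+ m.+1 * N%:R ^+ (2 * nu).-1); last first.
    by rewrite -ptE; ring.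
  apply: (@le_trans _ _ (r ^+ (2 * nu) * ((2 * K) ^ nu)%:R)).
    by rewrite ler_wpM2l // exprn_ge0.
  rewrite expnMn natrM mulrCA.
  apply: (le_trans (ler_wpM2l _ rK)); first by rewrite ler0n.
  by rewrite -!natrX -!natrM ler_nat; nia.
rewrite ler_wpM2r ?exprn_ge0 // ler_pM ?powR_ge0 ?ler0n //; last exact: ler_powR.
rewrite powR_mulrn ?ler0n // nu2 exprS ler_peMr ?ler0n // exprn_ege1 // ler1n.
by rewrite muln_gt0 c0 expn_gt0.
Qed.

Theorem theorem4 (R : realType) (m d nu : nat)
    (hm : (1 <= m)%N) (hd : (2 <= d)%N) (hnu : (1 <= nu)%N) :
  exists K : R,
    forall (p : nat) (hp : prime p) (hpm : (m < p)%N)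
      (f : 'I_m.+1 -> {mpoly 'F_p[m.+1]})
      (g h gt : 'I_m -> {mpoly 'F_p[m.+1]})
      (s : 'I_m -> 'I_m.+1 -> nat)
      (a b : 'F_p)
      (f_deg : family_degree f = d)
      (f_def : forall i : 'I_m, f (idx i) = 'X_(idx i) * g i + h i)
      (f_last : f ord_max = a *: 'X_ord_max + b%:MP)
      (a_neq0 : a != 0)
      (g_vars : forall i : 'I_m, in_vars_gt i (g i))
      (h_vars : forall i : 'I_m, in_vars_gt i (h i))
      (gt_vars : forall i : 'I_m, in_vars_gt i (gt i))
      (g_def : forall i : 'I_m,
        g i = \prod_(j < m.+1 | (i < j)%N) 'X_j ^+ s i j + gt i)
      (gt_deg : forall i : 'I_m, (msize (gt i) < msize (g i))%N)
      (g_deg : forall i : 'I_m,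
        msize (g i) = (\sum_(j < m.+1 | (i < j)%N) s i j).+1)
      (h_deg : forall i : 'I_m, (msize (h i) <= msize (g i))%N)
      (s_neq0 : (\prod_(i < m) s i (idxS i))%N <> 0%N)
      (w0 : {ffun 'I_m.+1 -> 'F_p}) (T : nat)
      (hT : purely_periodic (orbit_seq f w0) T)
      (N : nat) (hN0 : (0 < N)%N) (hNT : (N <= T)%N)
      (c : 'I_m -> int)
      (hc : gcdn (\big[gcdn/0%N]_(i < m) `|c i|%N) p = 1%N),
    `|exp_sum R (orbit_seq f w0) c N|
      <= (real_complex R)
           (K * (p%:R `^ alpha_ R m nu) * (N%:R `^ (1 - beta_ R nu))).
Proof.
exists ((4 ^ nu * (nu ^ nu + d.+1 ^ m + nu + 1)) * 2 ^ nu)%:R.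
move=> p p_prime _ f g h gt s a b f_deg f_def f_last a_neq0 g_vars h_vars _ _ _.
move=> g_deg h_deg s_neq0 w0 T w_per N N_gt0 N_le c c_coprime.
(* s_(i,i+1) is positive, so g_i is not constant. *)
have gt1 i : (1 < msize (g i))%N.
  rewrite g_deg ltnS (bigD1 (idxS i)) //= addn_gt0; apply/orP; left.
  rewrite lt0n; apply/eqP => si0; apply: s_neq0.
  by rewrite (bigD1 i) //= si0 mul0n.
have tri : triangular_system d f g h.
  have g0 i : g i != 0 by rewrite -msize_poly_eq0 -lt0n ltnW.
  have X0 i : 'X_i != 0 :> {mpoly 'F_p[m.+1]} by rewrite -msize_poly_eq0 msizeX.
  split=> //; first by exists (a, b).
  move=> i; rewrite -f_deg.
  apply: leq_trans (leq_bigmax (idx i)); rewrite f_def msizeDl.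
    by rewrite msizeM // msizeX mdeg1 /= leq_pred.
  by rewrite msizeM // msizeX mdeg1 /= ltnS.
have mnu_gt0 : (0 < m + nu)%N by rewrite addn_gt0 hm.
have [K [K_gt0 K_le K_ge]] := trunc_root mnu_gt0 (prime_gt0 p_prime).
rewrite exp_sumE //; set S := \sum_(n < N) _.
have core := exp_sum_core p_prime (std_charD R p_prime) (std_char0 R p)
  (fun x => e_norm R p (x : nat)%:Z) (std_char_sum R p_prime) tri
  (coprime_coef_neq0 p_prime c_coprime) K_gt0 w_per N_gt0 N_le hnu hm K_le.
have SE : `|S| = (Num.sqrt (complex.Re S ^+ 2 + complex.Im S ^+ 2))%:C%C := normc_def S.
have r0 : 0 <= Num.sqrt (complex.Re S ^+ 2 + complex.Im S ^+ 2) := sqrtr_ge0 _.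
move: core r0; rewrite -/S SE; move: (Num.sqrt _) => r core r0.
rewrite lecR; apply: (root_bound r0 hm hnu (prime_gt0 p_prime) N_gt0 _ K_ge).
  by rewrite muln_gt0 expn_gt0 addn1.
rewrite -lecR [X in X <= _]rmorphM rmorphXn !rmorph_nat; exact: core.
Qed.
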